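(* Let $(A,\cdot_A,\Delta,P,Q)$ be an averaging commutative and cocommutative infinitesimal bialgebra. Then there is a special apre-perm bialgebra $(A,\triangleright_A,\triangleleft_A,\vartheta,\theta)$, where for all $x,y\in A$, $$x\triangleright_A y=P(x)\cdot_A y+Q(x\cdot_A y),\qquad x\triangleleft_A y=-Q(x\cdot_A y),$$ $$\vartheta(x)=(Q\otimes\mathrm{id})\Delta(x)+\Delta(P(x)),\qquad \theta(x)=-\Delta(P(x)).$$
   Context: All vector spaces and algebras are finite-dimensional over an algebraically closed field $\mathbb K$ of characteristic zero; ''commutative algebra'' means commutative associative algebra. For a bilinear operation $\circ$ on $A$: $\mathcal L_\circ(x)y=x\circ y$, $\mathcal R_\circ(x)y=y\circ x$. $\tau$ is the flip on $A\otimes A$. An averaging commutative and cocommutative infinitesimal bialgebra $(A,\cdot_A,\Delta,P,Q)$ is a vector space $A$ with linear maps $\cdot_A:A\otimes A\to A$, $\Delta:A\to A\otimes A$, $P,Q:A\to A$ such that: $(A,\cdot_A)$ is a commutative algebra; $\Delta=\tau\Delta$ and $(\Delta\otimes\mathrm{id})\Delta=(\mathrm{id}\otimes\Delta)\Delta$; $\Delta(x\cdot_A y)=(\mathcal L_{\cdot_A}(x)\otimes\mathrm{id})\Delta(y)+(\mathrm{id}\otimes\mathcal L_{\cdot_A}(y))\Delta(x)$; $P(x)\cdot_A P(y)=P(P(x)\cdot_A y)$; $P(x)\cdot_A Q(y)=Q(P(x)\cdot_A y)=Q(x\cdot_A Q(y))$; $(Q\otimes Q)\Delta(x)=(Q\otimes\mathrm{id})\Delta(Q(x))$;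 and $(Q\otimes P)\Delta(x)=(Q\otimes\mathrm{id})\Delta(P(x))=(\mathrm{id}\otimes P)\Delta(P(x))$, for all $x,y\in A$. A perm algebra $(A,\circ_A)$ satisfies $x\circ_A(y\circ_A z)=(x\circ_A y)\circ_A z=(y\circ_A x)\circ_A z$. An apre-perm algebra is a vector space $A$ with multiplications $\triangleright_A,\triangleleft_A$ such that, setting $x\circ_A y=x\triangleright_A y+x\triangleleft_A y$ and $x\bullet_A y=x\triangleright_A y+y\triangleleft_A x$, $(A,\circ_A)$ is a perm algebra and for all $x,y,z$: $(x\circ_A y)\bullet_A z=x\bullet_A(y\bullet_A z)=y\bullet_A(x\bullet_A z)$ and $z\triangleleft_A(x\circ_A y)=-(z\triangleleft_A y)\triangleleft_A x=x\bullet_A(z\triangleleft_A y)=(x\bullet_A z)\triangleleft_A y$. It is special if $\triangleleft_A$ is commutative. A special apre-perm coalgebra $(A,\vartheta,\theta)$: with $\eta=\vartheta+\theta$, for all $x$: $(\eta\otimes\mathrm{id})\eta(x)=(\mathrm{id}\otimes\eta)\eta(x)$, $(\mathrm{id}\otimes\eta)\eta(x)=(\tau\otimes\mathrm{id})(\eta\otimes\mathrm{id})\eta(x)$, $\theta(x)=\tau\theta(x)$, $(\eta\otimes\mathrm{id})\theta(x)=(\mathrm{id}\otimes\theta)\eta(x)$, $(\mathrm{id}\otimes\theta)(\eta+\theta)(x)=0$. A special apre-perm bialgebra $(A,\triangleright_A,\triangleleft_A,\vartheta,\theta)$ is a special apre-perm algebra $(A,\triangleright_A,\triangleleft_A)$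 and a special apre-perm coalgebra $(A,\vartheta,\theta)$ such that for all $x,y\in A$, with $\eta=\vartheta+\theta$ and $\circ_A=\triangleright_A+\triangleleft_A$: (1) $\eta(x\circ_A y)=(\mathcal L_{\circ_A}(x)\otimes\mathrm{id})\eta(y)-(\mathrm{id}\otimes\mathcal R_{\circ_A}(y))\theta(x)$; (2) $\eta(x\circ_A y)=(\mathrm{id}\otimes\mathcal R_{\circ_A}(y))\eta(x)-(\mathcal L_{\triangleleft_A}(x)\otimes\mathrm{id})\eta(y)$; (3) $\eta(x\circ_A y)=(\mathrm{id}\otimes\mathcal L_{\circ_A}(x))\eta(y)+(\mathcal L_{\triangleleft_A}(y)\otimes\mathrm{id})\theta(x)$; (4) $\eta(x\triangleleft_A y)=(\mathrm{id}\otimes\mathcal L_{\triangleleft_A}(x))\eta(y)+\tau(\mathrm{id}\otimes\mathcal L_{\triangleleft_A}(y))\eta(x)$; (5) $\eta(x\triangleleft_A y)=\tau\eta(x\triangleleft_A y)$; (6) $\theta(x\circ_A y)=(\mathrm{id}\otimes\mathcal L_{\circ_A}(x))\theta(y)+(\mathcal L_{\circ_A}(y)\otimes\mathrm{id})\theta(x)$; (7) $\theta(x\circ_A y)=\theta(y\circ_A x)$. *)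

(* Defs.v *)
From HB Require Import structures.
From mathcomp Require Import all_boot all_order all_algebra.

Set Implicit Arguments.
Unset Strict Implicit.
Unset Printing Implicit Defensive.

Import GRing.Theory.
Local Open Scope ring_scope.

(* Tensor products of finite-dimensional spaces. The space U ⊗ V is realised
   on coordinates in the bases [bas]: the entries of a matrix t are the
   coefficients of t on the tensors bas i ⊗ bas j, see [tensor_sum]. The
   construction is independent of this choice by the universal property,
   [tens_bilinear], [tliftE] and [tensor_ext]. *)

Section Tensor.
Variable K : fieldType.
Implicit Types U V W : vectType K.

Definition tensor U V : vectType K := 'M[K]_(\dim {:U}, \dim {:V}).

Definition coef U V (t : tensor U V) (i : 'I_(\dim {:U})) (j : 'I_(\dim {:V})) : K :=
  (t : 'M[K]_(\dim {:U}, \dim {:V})) i j.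

Definition bas U (i : 'I_(\dim {:U})) : U := (vbasis {:U})`_i.

Definition tens U V (u : U) (v : V) : tensor U V :=
  \matrix_(i, j) (coord (vbasis {:U}) i u * coord (vbasis {:V}) j v).

Local Notation "u ⊗ v" := (tens u v) (at level 40, left associativity).

(* The linear map U ⊗ V -> W induced by b, meaningful when b is bilinear. *)
Definition tlift U V W (b : U -> V -> W) : 'Hom(tensor U V, W) :=
  linfun (fun t : tensor U V => \sum_i \sum_j coef t i j *: b (bas i) (bas j)).

Definition tmap U V U' V' (f : 'Hom(U, U')) (g : 'Hom(V, V')) :
    'Hom(tensor U V, tensor U' V') :=
  tlift (fun u v => f u ⊗ g v).

Definition tflip U V : 'Hom(tensor U V, tensor V U) :=
  tlift (fun u v => v ⊗ u).

(* The canonical identification U ⊗ (V ⊗ W) = (U ⊗ V) ⊗ W. *)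
Definition tassoc U V W :
    'Hom(tensor U (tensor V W), tensor (tensor U V) W) :=
  tlift (fun u s => tlift (fun v w => (u ⊗ v) ⊗ w) s).

Lemma linfunP U V (f : U -> V) : linear f -> forall u, linfun f u = f u.
Proof.
move=> lf u.
pose F := GRing.isLinear.Build K U V _ f lf.
pose g : {linear U -> V} := HB.pack f F.
exact: (lfunE g).
Qed.

Lemma tens_bilinear U V : bilinear_for *:%R *:%R (@tens U V).
Proof.
by split=> [v a u u' | u a v v']; apply/matrixP=> i j;
  rewrite !mxE linearP /= ?mulrDl ?mulrDr ?mulrA // [_ * a]mulrC.
Qed.

Lemma bas_sum U (u : U) : u = \sum_i coord (vbasis {:U}) i u *: bas i.
Proof. exact: coord_vbasis (memvf u). Qed.

Lemma coord_bas U (i j : 'I_(\dim {:U})) :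
  coord (vbasis {:U}) i (bas j) = (i == j)%:R.
Proof. by rewrite coord_free 1?eq_sym //; exact: basis_free (vbasisP _). Qed.

Lemma tensor_sum U V (t : tensor U V) :
  t = \sum_i \sum_j coef t i j *: (bas i ⊗ bas j).
Proof.
rewrite [LHS]matrix_sum_delta.
apply: eq_bigr => i _; apply: eq_bigr => j _; congr (_ *: _).
by apply/matrixP=> k l; rewrite !mxE !coord_bas -natrM mulnb.
Qed.

Lemma tlift_sub U V W (b : U -> V -> W) (t : tensor U V) :
  tlift b t = \sum_i \sum_j coef t i j *: b (bas i) (bas j).
Proof.
rewrite /tlift linfunP // => a s s'.
rewrite scaler_sumr -big_split; apply: eq_bigr => i _.
rewrite scaler_sumr -big_split; apply: eq_bigr => j _.
by rewrite /coef !mxE scalerDl scalerA.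
Qed.

Lemma tliftE U V W (b : U -> V -> W) :
  bilinear_for *:%R *:%R b -> forall u v, tlift b (u ⊗ v) = b u v.
Proof.
move=> [bl br] u v.
have El v' : linfun (b^~ v') u = b u v' by rewrite linfunP //; exact: bl.
have Er u' : linfun (b u') v = b u' v by rewrite linfunP //; exact: br.
rewrite tlift_sub -El {2}[u]bas_sum linear_sum; apply: eq_bigr => i _.
rewrite linearZ /= linfunP; last exact: bl.
rewrite -Er {2}[v]bas_sum linear_sum scaler_sumr; apply: eq_bigr => j _.
rewrite linearZ /= linfunP; last exact: br.
by rewrite /coef mxE scalerA.
Qed.

Lemma tensor_ext U V W (f g : 'Hom(tensor U V, W)) :
  (forall u v, f (u ⊗ v) = g (u ⊗ v)) -> f = g.
Proof.
move=> fg; apply/lfunP=> t; rewrite [t]tensor_sum !linear_sum.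
apply: eq_bigr => i _; rewrite !linear_sum; apply: eq_bigr => j _.
by rewrite !linearZ /= fg.
Qed.

Lemma tmapE U V U' V' (f : 'Hom(U, U')) (g : 'Hom(V, V')) u v :
  tmap f g (u ⊗ v) = f u ⊗ g v.
Proof.
rewrite tliftE //; split=> [w a x y | w a x y] /=; rewrite linearP /=.
  exact: (tens_bilinear _ _).1.
exact: (tens_bilinear _ _).2.
Qed.

Lemma tflipE U V (u : U) (v : V) : tflip U V (u ⊗ v) = v ⊗ u.
Proof.
rewrite tliftE //; split=> [w a x y | w a x y] /=.
  exact: (tens_bilinear _ _).2.
exact: (tens_bilinear _ _).1.
Qed.

Lemma tassocE U V W (u : U) (v : V) (w : W) :
  tassoc U V W (u ⊗ (v ⊗ w)) = (u ⊗ v) ⊗ w.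
Proof.
have B (u' : U) : bilinear_for *:%R *:%R (fun (x : V) (y : W) => (u' ⊗ x) ⊗ y).
  split=> [z a x y | z a x y] /=; last exact: (tens_bilinear _ _).2.
  by rewrite (tens_bilinear U V).2 (tens_bilinear _ W).1.
rewrite tliftE ?tliftE //; split=> [s a x y | x a s s'] /=.
  rewrite !tlift_sub scaler_sumr -big_split; apply: eq_bigr => i _.
  rewrite scaler_sumr -big_split; apply: eq_bigr => j _.
  rewrite (tens_bilinear U V).1 (tens_bilinear _ W).1 scalerDr !scalerA.
  by rewrite [a * _]mulrC.
by rewrite linearP.
Qed.

End Tensor.

Notation "u ⊗ v" := (tens u v) (at level 40, left associativity) : ring_scope.

Section Algebras.
Variables (K : fieldType) (A : vectType K).

(* A bilinear operation on A is a linear map m from A ⊗ A to A, its value on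
   x and y being m (x ⊗ y). *)
Notation binop := 'Hom(tensor A A, A).
Notation cobinop := 'Hom(A, tensor A A).
Implicit Types (m tri tle : binop) (D vth th : cobinop).

Definition Lop m (x : A) : 'End(A) := linfun (fun y => m (x ⊗ y)).
Definition Rop m (x : A) : 'End(A) := linfun (fun y => m (y ⊗ x)).

Lemma LopE m x y : Lop m x y = m (x ⊗ y).
Proof. by rewrite linfunP // => a u v; rewrite (tens_bilinear _ _).2 linearP. Qed.

Lemma RopE m x y : Rop m x y = m (y ⊗ x).
Proof. by rewrite linfunP // => a u v; rewrite (tens_bilinear _ _).1 linearP. Qed.

Local Notation id := (\1%VF : 'End(A)).
Local Notation τ := (tflip A A).
Local Notation assoc := (tassoc A A A).

Definition commutative_op m := forall x y, m (x ⊗ y) = m (y ⊗ x).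

Record commutative_algebra m : Prop := CommutativeAlgebra {
  comalg_mulC : commutative_op m;
  comalg_mulA : forall x y z, m (m (x ⊗ y) ⊗ z) = m (x ⊗ m (y ⊗ z)) }.

Record averaging_inf_bialgebra m D (P Q : 'End(A)) : Prop :=
  AveragingInfBialgebra {
  aib_comalg : commutative_algebra m;
  aib_cocomm : forall x, D x = τ (D x);
  aib_coassoc : forall x, tmap D id (D x) = assoc (tmap id D (D x));
  aib_infinitesimal : forall x y,
    D (m (x ⊗ y)) = tmap (Lop m x) id (D y) + tmap id (Lop m y) (D x);
  aib_avg : forall x y, m (P x ⊗ P y) = P (m (P x ⊗ y));
  aib_adm1 : forall x y, m (P x ⊗ Q y) = Q (m (P x ⊗ y));
  aib_adm2 : forall x y, Q (m (P x ⊗ y)) = Q (m (x ⊗ Q y));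
  aib_coavg : forall x, tmap Q Q (D x) = tmap Q id (D (Q x));
  aib_coadm1 : forall x, tmap Q P (D x) = tmap Q id (D (P x));
  aib_coadm2 : forall x, tmap Q id (D (P x)) = tmap id P (D (P x)) }.

Record perm_algebra m : Prop := PermAlgebra {
  perm_assoc : forall x y z, m (x ⊗ m (y ⊗ z)) = m (m (x ⊗ y) ⊗ z);
  perm_swap : forall x y z, m (m (x ⊗ y) ⊗ z) = m (m (y ⊗ x) ⊗ z) }.

Definition bullet tri tle : binop := tri + (tle \o τ)%VF.

Lemma bulletE tri tle x y :
  bullet tri tle (x ⊗ y) = tri (x ⊗ y) + tle (y ⊗ x).
Proof. by rewrite add_lfunE comp_lfunE tflipE. Qed.

Record apre_perm_algebra tri tle : Prop := AprePermAlgebra {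
  apre_perm : perm_algebra (tri + tle);
  apre_bul1 : let circ := tri + tle in let bul := bullet tri tle in
    forall x y z, bul (circ (x ⊗ y) ⊗ z) = bul (x ⊗ bul (y ⊗ z));
  apre_bul2 : let bul := bullet tri tle in
    forall x y z, bul (x ⊗ bul (y ⊗ z)) = bul (y ⊗ bul (x ⊗ z));
  apre_tle1 : let circ := tri + tle in
    forall x y z, tle (z ⊗ circ (x ⊗ y)) = - tle (tle (z ⊗ y) ⊗ x);
  apre_tle2 : let bul := bullet tri tle in
    forall x y z, - tle (tle (z ⊗ y) ⊗ x) = bul (x ⊗ tle (z ⊗ y));
  apre_tle3 : let bul := bullet tri tle in
    forall x y z, bul (x ⊗ tle (z ⊗ y)) = tle (bul (x ⊗ z) ⊗ y) }.

Definition special_apre_perm_algebra tri tle : Prop :=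
  apre_perm_algebra tri tle /\ commutative_op tle.

Record special_apre_perm_coalgebra vth th : Prop := SpecialAprePermCoalgebra {
  sapc_coassoc : let eta := vth + th in
    forall x, tmap eta id (eta x) = assoc (tmap id eta (eta x));
  sapc_coperm : let eta := vth + th in
    forall x, assoc (tmap id eta (eta x)) = tmap τ id (tmap eta id (eta x));
  sapc_sym : forall x, th x = τ (th x);
  sapc_mixed : let eta := vth + th in
    forall x, tmap eta id (th x) = assoc (tmap id th (eta x));
  sapc_zero : let eta := vth + th in
    forall x, tmap id th ((eta + th) x) = 0 }.

Record special_apre_perm_bialgebra tri tle vth th : Prop :=
  SpecialAprePermBialgebra {
  sapb_algebra : special_apre_perm_algebra tri tle;
  sapb_coalgebra : special_apre_perm_coalgebra vth th;
  sapb1 : let eta := vth + th in let circ := tri + tle in forall x y,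
    eta (circ (x ⊗ y)) =
      tmap (Lop circ x) id (eta y) - tmap id (Rop circ y) (th x);
  sapb2 : let eta := vth + th in let circ := tri + tle in forall x y,
    eta (circ (x ⊗ y)) =
      tmap id (Rop circ y) (eta x) - tmap (Lop tle x) id (eta y);
  sapb3 : let eta := vth + th in let circ := tri + tle in forall x y,
    eta (circ (x ⊗ y)) =
      tmap id (Lop circ x) (eta y) + tmap (Lop tle y) id (th x);
  sapb4 : let eta := vth + th in forall x y,
    eta (tle (x ⊗ y)) =
      tmap id (Lop tle x) (eta y) + τ (tmap id (Lop tle y) (eta x));
  sapb5 : let eta := vth + th in forall x y,
    eta (tle (x ⊗ y)) = τ (eta (tle (x ⊗ y)));
  sapb6 : let circ := tri + tle in forall x y,
    th (circ (x ⊗ y)) =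
      tmap id (Lop circ x) (th y) + tmap (Lop circ y) id (th x);
  sapb7 : let circ := tri + tle in forall x y,
    th (circ (x ⊗ y)) = th (circ (y ⊗ x)) }.

End Algebras.

(* Main.v *)
Require Import Defs.
From HB Require Import structures.
From mathcomp Require Import all_boot all_order all_algebra.

Set Implicit Arguments.
Unset Strict Implicit.
Unset Printing Implicit Defensive.

Import GRing.Theory.
Local Open Scope ring_scope.

(** Write [L x] for the multiplication by [x]. Since [Q (x * y)] cancels in
    the sum of the two products, and in the opposite-sided sum as well because
    the algebra is commutative, [circ] and [bullet] are the same product
    [x, y |-> P x * y]; likewise the sum [eta] of the two coproducts is
    [(Q ⊗ id) D]. So every axiom is an identity between words in [P], [Q],
    [L x] and [D].

    Two rules on endomorphisms govern these words: [Q] commutes with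
    [L (P x)] (lemma [mulP_Q]), and [Q L(x) Q = Q L(P x)] (lemma [Q_mul_Q]).
    Dually, a [P] on the second tensor factor of a coproduct can be moved
    inside [D] (lemmas [coadm_PP] and [coadm_QP]), and [(Q ⊗ id) D Q] is
    [(Q ⊗ Q) D], which is symmetric. For the compatibility conditions one
    expands [D] of a product by the infinitesimal identity, taking the two
    factors in the order that puts the multiplication operators on the sides
    that the condition asks for, and applies these rules factor by factor. As
    for the coalgebra axioms, both iterates of [eta] are the common iterate of
    [D] followed by [Q ⊗ Q ⊗ id], hence agree and are symmetric in the first
    two factors, and the axioms on [theta] follow by moving [P] inside [D]. *)

(** * Calculus of tensor products of linear maps *)

Section TensorCalculus.
Variable K : fieldType.
Implicit Types U V W : vectType K.

(** The opposite is itself a linear map, to which [linearN] also applies, so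
    that rewriting with [linearN] repeatedly diverges; this instance does not. *)
Lemma lfunN U V (f : 'Hom(U, V)) u : f (- u) = - f u.
Proof. exact: linearN. Qed.

Lemma tmap_comp U V U' V' U'' V'' (f : 'Hom(U', U'')) (g : 'Hom(V', V''))
    (f' : 'Hom(U, U')) (g' : 'Hom(V, V')) t :
  tmap f g (tmap f' g' t) = tmap (f \o f')%VF (g \o g')%VF t.
Proof.
rewrite -comp_lfunE; move: t; apply/lfunP/tensor_ext => u v.
by rewrite comp_lfunE !tmapE !comp_lfunE.
Qed.

Lemma tmap_id U V : tmap (\1 : 'End(U))%VF (\1 : 'End(V))%VF = \1%VF.
Proof. by apply: tensor_ext => u v; rewrite tmapE !id_lfunE. Qed.

Lemma tens_linearl U V (v : V) : linear (fun u : U => u ⊗ v).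
Proof. exact: (tens_bilinear U V).1. Qed.

Lemma tens_linearr U V (u : U) : linear (fun v : V => u ⊗ v).
Proof. exact: (tens_bilinear U V).2. Qed.

Lemma tensNl U V (u : U) (v : V) : (- u) ⊗ v = - (u ⊗ v).
Proof. by rewrite -!(linfunP (tens_linearl v)) lfunN. Qed.

Lemma tensNr U V (u : U) (v : V) : u ⊗ (- v) = - (u ⊗ v).
Proof. by rewrite -!(linfunP (tens_linearr u)) lfunN. Qed.

Lemma tmapNl U V U' V' (f : 'Hom(U, U')) (g : 'Hom(V, V')) t :
  tmap (- f) g t = - tmap f g t.
Proof.
rewrite -opp_lfunE; move: t; apply/lfunP/tensor_ext => u v.
by rewrite opp_lfunE !tmapE opp_lfunE tensNl.
Qed.

Lemma tmapNr U V U' V' (f : 'Hom(U, U')) (g : 'Hom(V, V')) t :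
  tmap f (- g) t = - tmap f g t.
Proof.
rewrite -opp_lfunE; move: t; apply/lfunP/tensor_ext => u v.
by rewrite opp_lfunE !tmapE opp_lfunE tensNr.
Qed.

Lemma tflip_tmap U V U' V' (f : 'Hom(U, U')) (g : 'Hom(V, V')) t :
  tflip U' V' (tmap f g t) = tmap g f (tflip U V t).
Proof.
rewrite -!comp_lfunE; move: t; apply/lfunP/tensor_ext => u v.
by rewrite !comp_lfunE tmapE !tflipE tmapE.
Qed.

Lemma tassoc_tmap U V W U' V' W' (f : 'Hom(U, U')) (g : 'Hom(V, V'))
    (h : 'Hom(W, W')) t :
  tassoc U' V' W' (tmap f (tmap g h) t) = tmap (tmap f g) h (tassoc U V W t).
Proof.
rewrite -!comp_lfunE; move: t; apply/lfunP/tensor_ext => u s.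
(* To use extensionality again, in s, both sides are read as linear maps
   applied to s by writing u ⊗ s as the image of s under one. *)
rewrite -(linfunP (tens_linearr u)) -!comp_lfunE.
move: s; apply/lfunP/tensor_ext => v w.
by rewrite !comp_lfunE (linfunP (tens_linearr u)) !(tmapE, tassocE).
Qed.

End TensorCalculus.

Section AveragingBialgebra.
Variables (K : fieldType) (A : vectType K).
Variables (m : 'Hom(tensor A A, A)) (D : 'Hom(A, tensor A A)) (P Q : 'End(A)).
Hypothesis hA : averaging_inf_bialgebra m D P Q.

Local Notation id := (\1%VF : 'End(A)).
Local Notation τ := (tflip A A).
Local Notation assoc := (tassoc A A A).
Local Notation L := (Lop m).

Let mulC : commutative_op m := comalg_mulC (aib_comalg hA).
Let mulA := comalg_mulA (aib_comalg hA).

(** * The induced products and coproducts *)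

Definition ind_tle : 'Hom(tensor A A, A) := - (Q \o m)%VF.
Definition ind_tri : 'Hom(tensor A A, A) := (m \o tmap P id)%VF + (Q \o m)%VF.
Definition ind_circ : 'Hom(tensor A A, A) := (m \o tmap P id)%VF.
Definition ind_th : 'Hom(A, tensor A A) := - (D \o P)%VF.
Definition ind_vth : 'Hom(A, tensor A A) := (tmap Q id \o D)%VF + (D \o P)%VF.
Definition ind_eta : 'Hom(A, tensor A A) := (tmap Q id \o D)%VF.

Lemma ind_circ_sum : ind_tri + ind_tle = ind_circ.
Proof. exact: addrK. Qed.

Lemma ind_eta_sum : ind_vth + ind_th = ind_eta.
Proof. exact: addrK. Qed.

Lemma ind_circE x y : ind_circ (x ⊗ y) = m (P x ⊗ y).
Proof. by rewrite comp_lfunE tmapE id_lfunE. Qed.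

Lemma ind_tleE x y : ind_tle (x ⊗ y) = - Q (m (x ⊗ y)).
Proof. by rewrite opp_lfunE comp_lfunE. Qed.

Lemma ind_triE x y : ind_tri (x ⊗ y) = m (P x ⊗ y) + Q (m (x ⊗ y)).
Proof. by rewrite add_lfunE !comp_lfunE tmapE id_lfunE. Qed.

Lemma ind_etaE x : ind_eta x = tmap Q id (D x).
Proof. exact: comp_lfunE. Qed.

Lemma ind_thE x : ind_th x = - D (P x).
Proof. by rewrite opp_lfunE comp_lfunE. Qed.

Lemma ind_bullet : bullet ind_tri ind_tle = ind_circ.
Proof.
apply: tensor_ext => x y.
by rewrite bulletE ind_triE ind_tleE ind_circE (mulC y x) addrK.
Qed.

(** * The apre-perm algebra *)

Lemma mul_swap x y z : m (x ⊗ m (y ⊗ z)) = m (y ⊗ m (x ⊗ z)).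
Proof. by rewrite -!mulA (mulC x y). Qed.

Lemma ind_perm_algebra : perm_algebra ind_circ.
Proof.
split=> x y z; rewrite !ind_circE -!(aib_avg hA) ?mulA //.
by rewrite mul_swap.
Qed.

Lemma ind_special_apre_perm_algebra :
  special_apre_perm_algebra ind_tri ind_tle.
Proof.
split; last by move=> x y; rewrite !ind_tleE mulC.
split; rewrite /= ?ind_bullet ?ind_circ_sum; first exact: ind_perm_algebra.
- by move=> x y z; rewrite (perm_assoc ind_perm_algebra).
- by move=> x y z; rewrite !ind_circE mul_swap.
- move=> x y z; rewrite !ind_tleE ind_circE tensNl !lfunN opprK /=.
  by rewrite [in RHS]mulC -(aib_adm2 hA) mul_swap.
- move=> x y z; rewrite !ind_tleE ind_circE tensNl tensNr !lfunN opprK /=.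
  by rewrite mulC (aib_adm1 hA) (aib_adm2 hA).
- move=> x y z; rewrite !ind_tleE !ind_circE tensNr lfunN /=.
  by rewrite (aib_adm1 hA) mulA -(aib_adm1 hA) (aib_adm1 hA).
Qed.

(** * The special apre-perm coalgebra *)

(** The coadmissibility conditions, followed by any map [f] on the second factor:
    this is the form in which they occur, [f] being [D] in the coalgebra axioms
    and a multiplication in the compatibility conditions. *)
Lemma coadm_PP (V : vectType K) (f : 'Hom(A, V)) x :
  tmap id (f \o P)%VF (D (P x)) = tmap Q f (D (P x)).
Proof.
have -> : tmap id (f \o P)%VF (D (P x)) = tmap id f (tmap id P (D (P x))).
  by rewrite tmap_comp comp_lfun1l.
by rewrite -(aib_coadm2 hA) tmap_comp comp_lfun1l comp_lfun1r.
Qed.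

Lemma coadm_QP (V : vectType K) (f : 'Hom(A, V)) x :
  tmap Q (f \o P)%VF (D x) = tmap Q f (D (P x)).
Proof.
have -> : tmap Q (f \o P)%VF (D x) = tmap id f (tmap Q P (D x)).
  by rewrite tmap_comp comp_lfun1l.
by rewrite (aib_coadm1 hA) tmap_comp comp_lfun1l comp_lfun1r.
Qed.

(** The outer [Q] of the left iterate sits inside the inner coproduct, as
    [(Q ⊗ id) D Q]; coaveraging turns this into [(Q ⊗ Q) D]. *)
Lemma ind_eta_iterl x :
  tmap ind_eta id (ind_eta x) = tmap (tmap Q Q) id (tmap D id (D x)).
Proof.
rewrite ind_etaE !tmap_comp !comp_lfun1r; congr (tmap _ _ _).
by apply/lfunP=> y; rewrite !comp_lfunE (aib_coavg hA).
Qed.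

Lemma ind_eta_iterr x :
  assoc (tmap id ind_eta (ind_eta x)) =
  tmap (tmap Q Q) id (assoc (tmap id D (D x))).
Proof.
by rewrite ind_etaE -tassoc_tmap !tmap_comp !comp_lfun1l !comp_lfun1r.
Qed.

Lemma ind_eta_coassoc x :
  tmap ind_eta id (ind_eta x) = assoc (tmap id ind_eta (ind_eta x)).
Proof. by rewrite ind_eta_iterl ind_eta_iterr (aib_coassoc hA). Qed.

Lemma ind_special_apre_perm_coalgebra :
  special_apre_perm_coalgebra ind_vth ind_th.
Proof.
split; rewrite /= ?ind_eta_sum => x.
- exact: ind_eta_coassoc.
- rewrite -ind_eta_coassoc ind_eta_iterl !tmap_comp !comp_lfun1l.
  congr (tmap _ _ _); apply/lfunP=> y; rewrite !comp_lfunE tflip_tmap.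
  by rewrite -(aib_cocomm hA).
- by rewrite ind_thE lfunN /= -(aib_cocomm hA).
- rewrite ind_thE ind_etaE tmap_comp comp_lfun1l comp_lfun1r !tmapNr !lfunN.
  rewrite coadm_QP; congr (- _).
  have -> : tmap ind_eta id (D (P x)) =
      tmap (tmap Q id) id (tmap D id (D (P x))).
    by rewrite tmap_comp comp_lfun1l.
  rewrite (aib_coassoc hA) -tassoc_tmap tmap_id tmap_comp.
  by rewrite comp_lfun1l comp_lfun1r.
- rewrite add_lfunE ind_etaE ind_thE linearB /= !tmapNr tmap_comp.
  by rewrite comp_lfun1l comp_lfun1r coadm_QP coadm_PP subrr.
Qed.

(** * The compatibility conditions *)

Lemma Lop_circ x : Lop ind_circ x = L (P x).
Proof. by apply/lfunP=> y; rewrite !LopE ind_circE. Qed.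

Lemma Rop_circ y : Rop ind_circ y = (L y \o P)%VF.
Proof. by apply/lfunP=> x; rewrite RopE comp_lfunE LopE ind_circE mulC. Qed.

Lemma Lop_tle x : Lop ind_tle x = - (Q \o L x)%VF.
Proof.
by apply/lfunP=> y; rewrite opp_lfunE comp_lfunE !LopE ind_tleE.
Qed.

Lemma mulP_Q x : (L (P x) \o Q)%VF = (Q \o L (P x))%VF.
Proof. by apply/lfunP=> y; rewrite !comp_lfunE !LopE (aib_adm1 hA). Qed.

Lemma Q_mul_Q x : (Q \o L x \o Q)%VF = (Q \o L (P x))%VF.
Proof. by apply/lfunP=> y; rewrite !comp_lfunE !LopE (aib_adm2 hA). Qed.

Lemma ind_bialgebra :
  special_apre_perm_bialgebra ind_tri ind_tle ind_vth ind_th.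
Proof.
split; rewrite /= ?ind_eta_sum ?ind_circ_sum.
- exact: ind_special_apre_perm_algebra.
- exact: ind_special_apre_perm_coalgebra.
- move=> x y; rewrite ind_circE !ind_etaE ind_thE Lop_circ Rop_circ.
  rewrite (aib_infinitesimal hA) !lfunN opprK linearD /= !tmap_comp.
  by rewrite coadm_PP mulP_Q !comp_lfun1l !comp_lfun1r.
- move=> x y; rewrite ind_circE !ind_etaE Lop_tle Rop_circ tmapNl opprK.
  rewrite (aib_infinitesimal hA) linearD /= !tmap_comp addrC.
  by rewrite !comp_lfun1l !comp_lfun1r coadm_QP Q_mul_Q.
- move=> x y; rewrite ind_circE !ind_etaE ind_thE Lop_circ Lop_tle.
  rewrite tmapNl !lfunN opprK mulC (aib_infinitesimal hA) linearD /=.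
  by rewrite !tmap_comp !comp_lfun1l !comp_lfun1r addrC.
- move=> x y; rewrite ind_tleE lfunN /= !ind_etaE -(aib_coavg hA) !Lop_tle.
  rewrite !tmapNr lfunN -opprD mulC (aib_infinitesimal hA) linearD /=.
  rewrite !tmap_comp tflip_tmap -(aib_cocomm hA).
  by rewrite !comp_lfun1l !comp_lfun1r addrC.
- move=> x y; rewrite ind_tleE !lfunN /= ind_etaE -(aib_coavg hA).
  by rewrite tflip_tmap -(aib_cocomm hA).
- move=> x y; rewrite ind_circE !ind_thE -(aib_avg hA) !Lop_circ.
  by rewrite mulC (aib_infinitesimal hA) !lfunN -opprD /= addrC.
- by move=> x y; rewrite !ind_circE !ind_thE -!(aib_avg hA) mulC.
Qed.

End AveragingBialgebra.

Theorem proposition4p13 (K : closedFieldType) (char0 : [pchar K] =i pred0)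
    (A : vectType K) (m : 'Hom(tensor A A, A)) (D : 'Hom(A, tensor A A))
    (P Q : 'End(A)) (hA : averaging_inf_bialgebra m D P Q) :
  exists (tri tle : 'Hom(tensor A A, A)) (vth th : 'Hom(A, tensor A A)),
    [/\ special_apre_perm_bialgebra tri tle vth th,
        forall x y : A, tri (x ⊗ y) = m (P x ⊗ y) + Q (m (x ⊗ y)),
        forall x y : A, tle (x ⊗ y) = - Q (m (x ⊗ y)),
        forall x : A, vth x = tmap Q \1%VF (D x) + D (P x)
      & forall x : A, th x = - D (P x)].
Proof.
exists (ind_tri m P Q), (ind_tle m Q), (ind_vth D P Q), (ind_th D P).
split; first exact: ind_bialgebra.
- exact: ind_triE.
- exact: ind_tleE.
- by move=> x; rewrite add_lfunE !comp_lfunE.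
- exact: ind_thE.
Qed.
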